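(* For every integer $n\ge 0$, $$r_{1,n}(q)=q^{\binom{n+2}{2}}-(q-1)^{n+1}[n+1]!=\sum_{k=0}^{n}(q-1)^k\,[k]!\;q^{\binom{n+2}{2}-\binom{k+2}{2}}.$$
   Context: Let $q$ be an indeterminate. Set $a(n,q)=q^{\binom n2}$ for integers $n\ge 0$ and $a(n,q)=0$ for integers $n<0$. For integers $m\ge 0$ and $n\ge 1$ define the Hankel determinant $$D_{-m,n}(q)=\det\bigl(a(-m+i+j,q)\bigr)_{i,j=0}^{n-1},$$ and set $D_{-m,0}(q)=1$. The determinant $D_{0,n+1}(q)$ is a nonzero polynomial for every $n\ge 0$, so for integers $m,n\ge 0$ a rational function $r_{m,n}(q)$ is uniquely determined by $$D_{-m,n+m+1}(q)=(-1)^{\binom{m+1}{2}}\,r_{m,n}(q)\,q^{m\binom n2}\,D_{0,n+1}(q).$$ Notation: $[n]=1+q+\cdots+q^{n-1}=\frac{q^n-1}{q-1}$ and $[n]!=[1][2]\cdots[n]$, with $[0]!=1$. *)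

(* Defs.v *)
From HB Require Import structures.
From mathcomp Require Import all_boot all_order all_algebra.
Set Implicit Arguments.
Unset Strict Implicit.
Unset Printing Implicit Defensive.
Import GRing.Theory.
Local Open Scope ring_scope.

(* The indeterminate q is the variable of {poly rat}; rational functions in q
   are the elements of {fraction {poly rat}}. *)
Notation q := ('X : {poly rat}) (only parsing).
Notation "p %:F" := (FracField.tofrac p) (format "p %:F") : ring_scope.

Definition a (n : int) : {poly rat} :=
  if n is Posz k then q ^+ 'C(k, 2) else 0.

(* D m n stands for D_{-m,n}(q); D m 0 = 1 is det_mx00. *)
Definition D (m n : nat) : {poly rat} :=
  \det (\matrix_(i < n, j < n) a (- m%:Z + i%:Z + j%:Z)).

Definition qint (n : nat) : {poly rat} := \sum_(i < n) q ^+ i.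

Definition qfact (n : nat) : {poly rat} := \prod_(k < n) qint k.+1.

(* The unique solution x of
     D_{-m,n+m+1} = (-1)^binom(m+1,2) x q^(m binom(n,2)) D_{0,n+1}:
   see r_characterization. *)
Definition r (m n : nat) : {fraction {poly rat}} :=
  (D m (n + m + 1))%:F /
    (((-1) ^+ 'C(m.+1, 2) * q ^+ (m * 'C(n, 2)) * D 0 n.+1)%:F).

Lemma bin2D i j : 'C(i + j, 2) = ('C(i, 2) + 'C(j, 2) + i * j)%N.
Proof.
elim: i => [|i IH]; first by rewrite add0n bin0n mul0n addn0.
rewrite addSn (binS (i + j)) (binS i) !bin1 IH mulSn.
by rewrite (addn.[AC (3 * 2) (1 * 4 * 2 * (5 * 3))]).
Qed.

Lemma D0_neq0 n : D 0 n != 0.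
Proof.
pose d : 'rV[{poly rat}]_n := \row_i 'X^'C(i, 2).
pose v : 'rV[{poly rat}]_n := \row_j 'X^j.
have -> : D 0 n = \det (diag_mx d *m Vandermonde n v *m diag_mx d).
  congr (\det _); apply/matrixP => i j.
  rewrite mul_mx_diag mul_diag_mx !mxE oppr0 add0r -PoszD /= bin2D.
  by rewrite -exprM -!exprD (mulnC j) addnAC.
rewrite !det_mulmx !det_diag det_Vandermonde.
have d0 : \prod_i d 0 i != 0.
  by apply/prodf_neq0 => i _; rewrite mxE expf_neq0 ?polyX_eq0.
rewrite !mulf_neq0 //; apply/prodf_neq0 => i _; apply/prodf_neq0 => j ij.
rewrite !mxE subr_eq0; apply/eqP => /(congr1 (fun p : {poly rat} => size p)).
by rewrite !size_polyXn => -[] /eqP; rewrite gtn_eqF.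
Qed.

Lemma r_characterization m n (x : {fraction {poly rat}}) :
  (D m (n + m + 1))%:F
    = (-1) ^+ 'C(m.+1, 2) * x * q%:F ^+ (m * 'C(n, 2)) * (D 0 n.+1)%:F
  <-> x = r m n.
Proof.
have nz : ((-1) ^+ 'C(m.+1, 2) * q ^+ (m * 'C(n, 2)) * D 0 n.+1)%:F != 0.
  by rewrite tofrac_eq0 !mulf_neq0 ?D0_neq0 ?signr_eq0 ?expf_neq0 ?polyX_eq0.
rewrite -tofracXn.
have -> : (-1) ^+ 'C(m.+1, 2) * x * (q ^+ (m * 'C(n, 2)))%:F * (D 0 n.+1)%:F
  = x * ((-1) ^+ 'C(m.+1, 2) * q ^+ (m * 'C(n, 2)) * D 0 n.+1)%:F.
  by rewrite !tofracM [in RHS]tofracXn tofracN tofrac1 !mulrA (mulrC x).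
split=> [e | ->]; last by rewrite divfK.
by rewrite /r e mulfK.
Qed.

(* Main.v *)
Require Import Defs.
From mathcomp Require Import all_boot all_order all_algebra.
From mathcomp Require Import ring.
Import GRing.Theory.
Local Open Scope ring_scope.

(** Up to the row and column factors q^binom(i-1,2), the matrix of D_{-1,n+2}
    is the Vandermonde matrix (q^(ij)) with its (0,0) entry replaced by 0.
    Expanding along the first row, its determinant is a difference of two
    Vandermonde determinants: the full one, which yields (q-1)^(n+1) [n+1]!,
    and the minor (q^((i+1)(j+1))), which yields q^binom(n+2,2). Both are
    multiples of det (q^(ij))_{i,j<=n}, to which D_{0,n+1} also reduces. *)

(** The cofactors along row 0 do not involve row 0, so the Laplace expansion along that row is
    affine in the (0,0) entry. *)
Lemma det_sub_delta00 (R : comNzRingType) n (A : 'M[R]_n.+1) (c : R) :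
  \det (A - c *: delta_mx ord0 ord0)
    = \det A - c * \det (row' ord0 (col' ord0 A)).
Proof.
have cofE j : cofactor (A - c *: delta_mx ord0 ord0) ord0 j
    = cofactor A ord0 j.
  congr (_ * \det _); apply/matrixP => i k.
  by rewrite !mxE [lift _ i == _]eq_sym (negPf (neq_lift _ _)) mulr0 subr0.
rewrite (expand_det_row (A - _) ord0) (expand_det_row A ord0).
rewrite !big_ord_recl !cofE.
have -> : \det (row' ord0 (col' ord0 A)) = cofactor A ord0 ord0.
  by rewrite /cofactor addn0 expr0 mul1r.
rewrite !mxE !eqxx mulr1 mulrBl addrAC; congr (_ + _ - _).
by apply: eq_bigr => j _; rewrite cofE !mxE eqxx /= mulr0 subr0.
Qed.

Definition qvdm n : 'M[{poly rat}]_n := \matrix_(i, j) q ^+ (i * j).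

Lemma det_qvdm n :
  \det (qvdm n) = \prod_(j < n) \prod_(i < j) (q ^+ j - q ^+ i).
Proof.
have -> : qvdm n = Vandermonde n (\row_j q ^+ j).
  by apply/matrixP => i j; rewrite !mxE -exprM mulnC.
(* Grouping by the larger index makes the passage from [n] to [n.+1] add one outer factor, as
   [det_qvdmS] needs. *)
rewrite det_Vandermonde (exchange_big_dep xpredT) //=.
apply: eq_bigr => j _.
rewrite [RHS](big_ord_widen n (fun i => q ^+ j - q ^+ i) (ltnW (ltn_ord j))).
by apply: eq_bigr => i _; rewrite !mxE.
Qed.

Lemma qint_mulB1 n : (q - 1) * qint n = q ^+ n - 1.
Proof. by rewrite -subrX1. Qed.

Lemma qfactS n : qfact n.+1 = qfact n * qint n.+1.
Proof. exact: big_ord_recr. Qed.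

Lemma prodXn n : \prod_(i < n) q ^+ i = q ^+ 'C(n, 2).
Proof. by rewrite prodrXr -(big_mkord xpredT id) bin2_sum. Qed.

Lemma prod_qnB n :
  \prod_(i < n) (q ^+ n - q ^+ i) = q ^+ 'C(n, 2) * ((q - 1) ^+ n * qfact n).
Proof.
rewrite (reindex_inj rev_ord_inj) /=.
(* After the reversal, q^n - q^(n-1-i) = q^(n-1-i) (q^(i+1) - 1). *)
transitivity (\prod_(i < n) (q ^+ rev_ord i * ((q - 1) * qint i.+1))).
  apply: eq_bigr => i _; rewrite qint_mulB1 mulrBr mulr1 -exprD /=.
  by rewrite subnK.
rewrite !big_split /= prodr_const card_ord; congr (_ * _).
by rewrite -prodXn [RHS](reindex_inj rev_ord_inj).
Qed.

Lemma det_qvdmS n :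
  \det (qvdm n.+1)
    = \det (qvdm n) * (q ^+ 'C(n, 2) * ((q - 1) ^+ n * qfact n)).
Proof. by rewrite !det_qvdm big_ord_recr /= prod_qnB. Qed.

Lemma det_scale_rows_cols (R : comNzRingType) n (d : 'I_n -> R) (A : 'M[R]_n) :
  \det (\matrix_(i, j) (d i * A i j * d j)) = (\prod_i d i) ^+ 2 * \det A.
Proof.
pose v := \row_i d i.
have -> : \matrix_(i, j) (d i * A i j * d j) = diag_mx v *m A *m diag_mx v.
  by apply/matrixP => i j; rewrite mul_mx_diag mul_diag_mx !mxE.
rewrite !det_mulmx det_diag.
have -> : \prod_i v 0 i = \prod_i d i by apply: eq_bigr => i _; rewrite mxE.
by rewrite expr2 mulrAC.
Qed.

Lemma D0_qvdm n : D 0 n = (\prod_(i < n) q ^+ 'C(i, 2)) ^+ 2 * \det (qvdm n).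
Proof.
rewrite -det_scale_rows_cols; congr (\det _); apply/matrixP => i j.
by rewrite !mxE oppr0 add0r -PoszD /= bin2D -!exprD addnAC.
Qed.

(** Since (i+1)(j+1) = i + ij + (j+1), row i releases q^i and column j releases q^(j+1). *)
Lemma det_qvdm_minor n :
  \det (row' ord0 (col' ord0 (qvdm n.+1)))
    = q ^+ ('C(n, 2) + 'C(n.+1, 2)) * \det (qvdm n).
Proof.
pose v := \row_(i < n) q ^+ i : 'rV[{poly rat}]_n.
pose w := \row_(i < n) q ^+ i.+1 : 'rV[{poly rat}]_n.
have -> : row' ord0 (col' ord0 (qvdm n.+1)) = diag_mx v *m qvdm n *m diag_mx w.
  apply/matrixP => i j; rewrite mul_mx_diag mul_diag_mx !mxE !lift0 -!exprD.
  by congr (_ ^+ _); rewrite mulSn mulnS addnC.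
rewrite !det_mulmx !det_diag mulrAC; congr (_ * _).
rewrite exprD -!prodXn [in RHS]big_ord_recl expr0 mul1r.
by congr (_ * _); apply: eq_bigr => i _; rewrite mxE.
Qed.

Lemma a_predS i j : a (- 1%:Z + i.+1%:Z + j%:Z) = q ^+ 'C(i + j, 2).
Proof. by rewrite (intS i) addKr -PoszD. Qed.

(** For i + j > 0, binom(i+j-1,2) = binom(i-1,2) + binom(j-1,2) + ij - 1; the -1 costs one factor q
    in each of the n+1 rows. At (0,0) this formula would give a nonzero entry where a(-1) = 0, hence
    the subtracted 1. *)
Lemma D1_qvdm n :
  D 1 n.+1 * q ^+ n.+1
    = (q * \prod_(i < n) q ^+ 'C(i, 2)) ^+ 2
      * \det (qvdm n.+1 - 1 *: delta_mx ord0 ord0).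
Proof.
(* f i = q^binom(i-1,2), where binom(-1,2) = 1. *)
pose f i : {poly rat} := if i is k.+1 then q ^+ 'C(k, 2) else q.
have -> : q * \prod_(i < n) q ^+ 'C(i, 2) = \prod_(i < n.+1) f i.
  by rewrite big_ord_recl.
rewrite -det_scale_rows_cols mulrC -detZ; congr (\det _).
apply/matrixP => -[[|i] ilt] [[|j] jlt]; rewrite !mxE -!val_eqE [RHS]/=.
- by rewrite [LHS]mulr0 mulr1 expr0 subrr mulr0 mul0r.
- by rewrite addrAC a_predS addn0 mulr0 subr0 mul0n expr0 mulr1.
- by rewrite a_predS addn0 mulr0 subr0 muln0 expr0 mulr1 mulrC.
- rewrite a_predS /= mulr0 subr0 bin2D binS bin1 -exprS -!exprD.
  by congr (_ ^+ _); rewrite mulSn !mulnS; ring.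
Qed.

Lemma D1_D0 n :
  D 1 n.+2 = - ((q ^+ 'C(n.+2, 2) - (q - 1) ^+ n.+1 * qfact n.+1)
                * (q ^+ 'C(n, 2) * D 0 n.+1)).
Proof.
apply: (mulIf (expf_neq0 n.+2 (negbT (polyX_eq0 rat)))).
rewrite D1_qvdm det_sub_delta00 det_qvdmS det_qvdm_minor D0_qvdm.
(* The powers of q match because 2 + binom(n+1,2) = (n+2) + binom(n,2). *)
by rewrite [in 'C(n.+1, 2)]binS bin1 !exprD !exprS; ring.
Qed.

(** Both sides satisfy S(n+1) = q^(n+1) S(n) + (q-1)^n [n]! with S(0) = 0; on the left this is
    (q-1)[n+1] = q^(n+1) - 1. *)
Lemma qfact_telescope n :
  q ^+ 'C(n.+1, 2) - (q - 1) ^+ n * qfact n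
    = \sum_(0 <= k < n)
        (q - 1) ^+ k * qfact k * q ^+ ('C(n.+1, 2) - 'C(k.+2, 2)).
Proof.
elim: n => [|n IH]; first by rewrite big_geq // /qfact big_ord0 !mulr1 subrr.
rewrite big_nat_recr //= subnn expr0 mulr1.
have -> : \sum_(0 <= k < n)
      (q - 1) ^+ k * qfact k * q ^+ ('C(n.+2, 2) - 'C(k.+2, 2))
    = (q ^+ 'C(n.+1, 2) - (q - 1) ^+ n * qfact n) * q ^+ n.+1.
  rewrite IH mulr_suml; apply: eq_big_nat => k /andP[_ kn].
  (* As k < n, binom(k+2,2) <= binom(n+1,2), so the natural subtraction does not truncate. *)
  rewrite -[in RHS]mulrA -exprD (binS n.+1 1) bin1 addnBAC //.
  by rewrite leq_bin2l.
rewrite qfactS (binS n.+1 1) bin1 exprD.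
have -> : (q - 1) ^+ n.+1 * (qfact n * qint n.+1)
    = (q - 1) ^+ n * qfact n * ((q - 1) * qint n.+1) by rewrite exprS; ring.
by rewrite qint_mulB1; ring.
Qed.

Theorem theorem1 (n : nat) :
  r 1 n = (q ^+ 'C(n.+2, 2) - (q - 1) ^+ n.+1 * qfact n.+1)%:F
  /\ q ^+ 'C(n.+2, 2) - (q - 1) ^+ n.+1 * qfact n.+1
     = \sum_(0 <= k < n.+1)
         (q - 1) ^+ k * qfact k * q ^+ ('C(n.+2, 2) - 'C(k.+2, 2)).
Proof.
split; last exact: qfact_telescope.
apply/esym/r_characterization.
rewrite !addn1 D1_D0 mul1n binn expr1 mulN1r tofracN !tofracM tofracXn.
by rewrite !mulNr mulrA.
Qed.
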